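(* No Harmonic-type algorithm for two-dimensional online hypercube (square) packing can achieve an asymptotic performance ratio better than $2.0208$.
   Context: Online hypercube packing in dimension $d$ (here $d=2$): items are axis-parallel hypercubes of side length in $(0,1]$ arriving online; each must be irrevocably placed, non-overlapping and without rotation, into a unit hypercube bin upon arrival; the goal is to minimize the number of used bins. The asymptotic performance ratio of $\mathcal{A}$ is $\limsup_{n\to\infty}\sup_\sigma\{\mathcal{A}(\sigma)/OPT(\sigma): OPT(\sigma)=n\}$, where $\mathcal{A}(\sigma)$ and $OPT(\sigma)$ are the numbers of bins used by $\mathcal{A}$ and by an optimal offline packing. A Harmonic-type algorithm is an online algorithm for which there are an integer $h\ge1$, rational numbers $1/3=y_0<y_1<\dots<y_h<y_{h+1}=1/2$ and $0<\lambda\le1/3$ such that it distinguishes (possibly among other classes) the disjoint side-length intervals $\overline I_1=(1-y_1,1]$, $I_{1,j}=(1-y_{j+1},1-y_j]$ ($j=1,\dots,h$), $\overline I_2=(y_h,1/2]$, $I_{2,j}=(y_{h-j},y_{h-j+1}]$ ($j=1,\dots,h$), $I_\lambda=(0,\lambda]$, and obeys: (1) for each $j\in\{1,\dots,h\}$ there is a constant $m_j$ such that a $1/m_j$-fraction of the items with side length in $I_{2,j}$ are packed $2^d-1$ per bin (''red'') and the rest are packed $2^d$ per bin (''blue''); (2) no bin contains an item with side in $I_{1,i}$ and an item with side in $I_{2,j}$ if $i+j\le h$; (3) no bin contains an item with side in $\overline I_1$ and an item with side in some $I_{2,j}$; (4) no bin contains an item with side in some $I_{1,j}$ and an item with side in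 $\overline I_2$; (5) no bin containing an item with side in $I_\lambda$ contains an item with side in any $I_{1,j}$, $I_{2,j}$, $\overline I_1$ or $\overline I_2$. *)

(* Defs.v *)
From mathcomp Require Import all_boot all_order all_algebra.
From mathcomp Require Import all_classical all_reals all_analysis.

Set Implicit Arguments.
Unset Strict Implicit.
Unset Printing Implicit Defensive.

Import Order.TTheory GRing.Theory Num.Theory.

Local Open Scope classical_set_scope.
Local Open Scope ring_scope.

(* An input is the sequence of the side lengths, in order of arrival. *)
Definition is_input (R : realType) (s : seq R) : Prop :=
  forall x, x \in s -> 0 < x <= 1.

(* Index of the bin, and corner of the hypercube with least coordinates,
   relative to the bin. *)
Definition placement (R : realType) (d : nat) : Type := (nat * 'rV[R]_d)%type.

Definition cube (R : realType) (d : nat) (p : 'rV[R]_d) (a : R)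
    : set 'rV[R]_d :=
  [set x | forall k, p 0 k <= x 0 k <= p 0 k + a].

Definition open_cube (R : realType) (d : nat) (p : 'rV[R]_d) (a : R)
    : set 'rV[R]_d :=
  [set x | forall k, p 0 k < x 0 k < p 0 k + a].

(* [P i] is the placement of the item of index [i], for [i < size s]; the
   other values of [P] are irrelevant. *)
Definition is_packing (R : realType) (d : nat) (s : seq R)
    (P : nat -> placement R d) : Prop :=
  (forall i, (i < size s)%N -> cube (P i).2 s`_i `<=` cube 0 1) /\
  (forall i j, (i < size s)%N -> (j < size s)%N -> i <> j ->
     (P i).1 = (P j).1 ->
     open_cube (P i).2 s`_i `&` open_cube (P j).2 s`_j = set0).

Definition used_bins (R : realType) (d : nat) (s : seq R)
    (P : nat -> placement R d) : seq nat :=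
  undup [seq (P i).1 | i <- iota 0 (size s)].

Definition num_bins (R : realType) (d : nat) (s : seq R)
    (P : nat -> placement R d) : nat :=
  size (used_bins s P).

Definition is_OPT (R : realType) (d : nat) (s : seq R) (n : nat) : Prop :=
  (exists P : nat -> placement R d, is_packing s P /\ num_bins s P = n) /\
  (forall P : nat -> placement R d, is_packing s P -> (n <= num_bins s P)%N).

(* [place s] is the placement of the last item of [s], decided when exactly
   the items of [s] have arrived. *)
Definition run (R : realType) (d : nat) (place : seq R -> placement R d)
    (s : seq R) (i : nat) : placement R d :=
  place (take i.+1 s).

Record online_algorithm (R : realType) (d : nat) := OnlineAlgorithm {
  place :> seq R -> placement R d;
  run_is_packing : forall s, is_input s -> is_packing s (run place s)
}.

Definition asymptotic_ratio (R : realType) (d : nat)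
    (A : online_algorithm R d) : \bar R :=
  limn_esup (fun n : nat =>
    ereal_sup [set ((num_bins s (run A s))%:R / n%:R)%:E |
                s in [set s : seq R | is_input s /\ is_OPT d s n]]).

Section HarmonicType.
Variables (R : realType) (d : nat) (A : online_algorithm R d).

Definition never_together (I J : interval R) : Prop :=
  forall s, is_input s ->
  forall i k, (i < size s)%N -> (k < size s)%N ->
  s`_i \in I -> s`_k \in J -> (run A s i).1 <> (run A s k).1.

Definition num_items (s : seq R) (c : pred nat) : nat :=
  count c (iota 0 (size s)).

(* Number of the bins that contain some item satisfying [c], but whose number
   of such items is not [q]. *)
Definition num_irregular (s : seq R) (c : pred nat) (q : nat) : nat :=
  count (fun b =>
           num_items s [pred i | c i & (run A s i).1 == b] \notin [:: 0%N; q])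
        (used_bins s (run A s)).

(* [red s i] tells whether the item of index [i] of the input [s] is red. As
   an online algorithm can realize neither the fraction [1 / m] nor full bins
   at every moment, the rule is asymptotic: the deviation from the fraction
   and the number of the bins that are not filled as prescribed are [o(n)],
   where [n] is the number of the items with side length in [I]. *)
Definition red_blue_rule (I : interval R) (m : R) : Prop :=
  exists red : seq R -> pred nat,
  forall eps : R, 0 < eps -> exists K : R,
  forall s, is_input s ->
    let n := (num_items s [pred i | s`_i \in I])%:R in
    let reds := [pred i | s`_i \in I & red s i] in
    let blues := [pred i | s`_i \in I & ~~ red s i] in
    [/\ `| (num_items s reds)%:R - n / m | <= eps * n + K,
        (num_irregular s reds (2 ^ d - 1))%:R <= eps * n + K
      & (num_irregular s blues (2 ^ d))%:R <= eps * n + K].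

Definition harmonic_rules (h : nat) (y : nat -> R) (lambda : R) : Prop :=
  let Ibar1 := `]1 - y 1%N, 1]%R in
  let I1 j := `]1 - y j.+1, 1 - y j]%R in
  let Ibar2 := `]y h, 1 / 2]%R in
  let I2 j := `]y (h - j)%N, y (h - j).+1]%R in
  let Ilambda := `]0, lambda]%R in
  [/\ forall j, (1 <= j <= h)%N ->
        exists m : R, 1 <= m /\ red_blue_rule (I2 j) m,
      forall i j, (1 <= i <= h)%N -> (1 <= j <= h)%N -> (i + j <= h)%N ->
        never_together (I1 i) (I2 j),
      forall j, (1 <= j <= h)%N -> never_together Ibar1 (I2 j),
      forall j, (1 <= j <= h)%N -> never_together (I1 j) Ibar2
    & [/\ forall j, (1 <= j <= h)%N -> never_together Ilambda (I1 j),
          forall j, (1 <= j <= h)%N -> never_together Ilambda (I2 j),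
          never_together Ilambda Ibar1
        & never_together Ilambda Ibar2]].

Definition harmonic_type : Prop :=
  exists (h : nat) (y : nat -> rat) (lambda : R),
    [/\ (1 <= h)%N,
        [/\ y 0%N = 1 / 3, y h.+1 = 1 / 2
          & forall j, (j <= h)%N -> y j < y j.+1],
        0 < lambda <= 1 / 3
      & harmonic_rules h (fun j => ratr (y j)) lambda].

End HarmonicType.

(* Main.v *)
(* Only the class (1/3, y_1] of the medium items matters.  Two inputs are made
   of N copies of one full bin, which contains a large square, three squares
   of side slightly more than 1/3 in the other corners, and sand, i.e. tiny
   squares, elsewhere; OPT = N since every item of side more than 1/2 needs
   its own bin.  Let x = 1/m be the fraction of the red items.
   - If the side of the large item is slightly less than 2/3, the algorithm
     keeps the three kinds of items apart and uses at least about
     N (1 + x + 3/4 (1 - x) + 2/9) bins.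
   - If it is slightly more than 1/2, large items can only join red ones, as at
     most four items of side more than 1/3 fit in a bin, so at least about
     N (1 + 3/4 (1 - x) + 5/12) bins are used.
   In the mean with weights 3/4 and 1/4 the terms in x cancel and the ratio
   is 97/48 = 2.02083... *)

Require Import Defs.
From mathcomp Require Import all_boot all_order all_algebra.
From mathcomp Require Import all_classical all_reals all_analysis.
From mathcomp Require Import zify ring lra.

Set Implicit Arguments.
Unset Strict Implicit.
Unset Printing Implicit Defensive.

Import Order.TTheory GRing.Theory Num.Theory.

Local Open Scope classical_set_scope.
Local Open Scope ring_scope.

(** * Counting items bin by bin *)

Definition items_in (R : realType) (d : nat) (s : seq R)
    (P : nat -> placement R d) (c : pred nat) (b : nat) : nat :=
  num_items s [pred i | c i & (P i).1 == b].

Section Counting.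
Variables (R : realType) (d : nat) (s : seq R) (P : nat -> placement R d).
Implicit Types (c e : pred nat) (b : nat).

Lemma num_items_value (p : pred R) :
  num_items s [pred i | p s`_i] = count p s.
Proof. by rewrite -[s in RHS](mkseq_nth 0) /mkseq count_map. Qed.

Lemma num_items_sum_bins c :
  num_items s c = (\sum_(b <- used_bins s P) items_in s P c b)%N.
Proof.
under [RHS]eq_bigr => b _.
  rewrite /items_in /num_items -sum1_count big_mkcond /=; over.
rewrite /num_items -sum1_count exchange_big /= big_mkcond; apply: eq_big_seq => i i_s.
have [ci|_] := boolP (c i); last by rewrite big1.
rewrite -big_mkcond /= sum1_count /=.
rewrite (eq_count (_ : _ =1 pred1 (P i).1)); last first.
  by move=> b /=; rewrite eq_sym.
by rewrite count_uniq_mem ?undup_uniq // mem_undup (map_f (fun i => (P i).1)).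
Qed.

Lemma items_in_disjoint c e b :
  (forall i, (i < size s)%N -> c i -> ~~ e i) ->
  (items_in s P c b + items_in s P e b = items_in s P (predU c e) b)%N.
Proof.
move=> dis; rewrite /items_in /num_items -count_predUI.
rewrite [X in (_ + X)%N](_ : _ = 0%N) ?addn0.
  by apply: eq_count => i /=; rewrite andb_orl.
rewrite (eq_in_count (a2 := pred0)) ?count_pred0 // => i.
rewrite mem_iota /= add0n => i_s.
by have [/(dis _ i_s)/negbTE->|] := boolP (c i); rewrite ?andbF.
Qed.

Lemma items_in_gt0 c b : (0 < items_in s P c b)%N ->
  exists i, [/\ (i < size s)%N, c i & (P i).1 = b].
Proof.
rewrite /items_in /num_items -has_count => /hasP[i].
by rewrite mem_iota /= add0n => i_s /andP[ci /eqP <-]; exists i.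
Qed.

Lemma items_in_separated c e b :
  (forall i k, (i < size s)%N -> (k < size s)%N -> c i -> e k ->
     (P i).1 <> (P k).1) ->
  items_in s P c b = 0%N \/ items_in s P e b = 0%N.
Proof.
move=> sep; have [|/items_in_gt0[i [i_s ci <-]]] := posnP (items_in s P c b).
  by left.
right; apply/eqP; rewrite -leqn0 leqNgt; apply/negP => /items_in_gt0[k [k_s ek]].
by move/esym; exact: sep.
Qed.

End Counting.

(** * How many large cubes fit in one bin *)

Section Geometry.
Variables (R : realType) (d : nat) (s : seq R) (P : nat -> placement R d).
Hypothesis Pp : is_packing s P.

Lemma packing_corner_bounds i k : (i < size s)%N -> 0 <= s`_i ->
  0 <= (P i).2 0 k /\ (P i).2 0 k + s`_i <= 1.
Proof.
move=> i_s s0; have sub := Pp.1 i i_s; split.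
  have /sub/(_ k) : cube (P i).2 s`_i (P i).2.
    by move=> j; rewrite lexx lerDl.
  by rewrite mxE add0r => /andP[].
have /sub/(_ k) : cube (P i).2 s`_i ((P i).2 + const_mx s`_i).
  by move=> j; rewrite !mxE lexx lerDl s0.
by rewrite !mxE add0r => /andP[].
Qed.

(* The open cube of an item of side more than [1 / (q + 2)] contains a point
   whose coordinates are all among [1 / (q + 2), ..., (q + 1) / (q + 2)]. *)
Lemma big_items_in_bin (q : nat) (c : pred nat) (b : nat) :
  (forall i, (i < size s)%N -> c i -> 1 / q.+2%:R < s`_i) ->
  (items_in s P c b <= q.+1 ^ d)%N.
Proof.
move=> big; pose n : R := q.+2%:R.
have n_gt0 : 0 < n by rewrite ltr0n.
(* Rounding [n] times the corner down and adding one, as [pt] does, gives the first grid coordinate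
   strictly after the corner. *)
pose f i := [ffun k : 'I_d => inord (Num.truncn (n * (P i).2 0 k)) : 'I_q.+1].
pose pt (g : {ffun 'I_d -> 'I_q.+1}) : 'rV[R]_d := \row_k ((g k).+1%:R / n).
have ptP i : (i < size s)%N -> c i -> open_cube (P i).2 s`_i (pt (f i)).
  move=> i_s ci k; have lt_s := big i i_s ci.
  have s0 : 0 <= s`_i by apply: le_trans (ltW lt_s); rewrite divr_ge0 ?ler0n.
  have [p0 p1] := packing_corner_bounds k i_s s0.
  set p := (P i).2 0 k in p0 p1 *.
  have := @truncn_itv R (n * p).
  rewrite mulr_ge0 ?(ltW n_gt0) // => /(_ isT) /andP[lo hi].
  move: lt_s; rewrite -/n ltr_pdivrMr // => lt_s.
  (* The side exceeds [1 / n], so the corner lies below [(q + 1) / n] and [inord] does not fall back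
     on its default value. *)
  have lt_q : (Num.truncn (n * p) < q.+1)%N.
    have : (Num.truncn (n * p)).+1%:R < q.+2%:R :> R.
      by rewrite -natr1 -/n; nra.
    by rewrite ltr_nat.
  rewrite mxE ffunE -/p inordK // ltr_pdivlMr // mulrC hi /= ltr_pdivrMr //.
  by rewrite -natr1; nra.
(* Pigeonhole: two items of one bin with equal values of [f] would have a common interior point, so
   [f] is injective on the bin. *)
rewrite -[q.+1 in X in (_ <= X)%N]card_ord -[d in X in (_ <= X)%N]card_ord -card_ffun.
rewrite /items_in /num_items -size_filter -(size_map f) cardT.
apply: uniq_leq_size => [|g]; last by rewrite mem_enum.
rewrite map_inj_in_uniq ?filter_uniq ?iota_uniq // => i j.
rewrite !mem_filter /= !mem_iota /= !add0n.
move=> /andP[/andP[ci /eqP bi] i_s] /andP[/andP[cj /eqP bj] j_s] fij.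
have [//|/eqP neq_ij] := eqVneq i j; exfalso.
have := Pp.2 i j i_s j_s neq_ij; rewrite bi bj => /(_ erefl).
apply/eqP/set0P; exists (pt (f i)); split; first exact: ptP.
by rewrite fij; exact: ptP.
Qed.

End Geometry.

(** A bound from some rank on is enough, so additive constants in the number of bins can be absorbed
    for large [N]. *)
Lemma limn_esup_ge (R : realType) (u : nat -> \bar R) (c : \bar R) (N : nat) :
  (forall n, (N <= n)%N -> (c <= u n)%E) -> (c <= limn_esup u)%E.
Proof.
move=> cu; rewrite limn_esup_lim; apply: lime_ge; first exact: is_cvg_esups.
near=> n; apply: (@le_trans _ _ (u n)).
  by apply: cu; near: n; exact: nbhs_infty_ge.
by apply: ereal_sup_ubound; exists n => /=.
Unshelve. all: by end_near. Qed.

(** * Integer tilings of the bin, completed by unit cells *)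

(* The tile [(u, v, w)] is the square with least corner [(u, v)] and side [w]
   of the grid that divides the bin into [K * K] cells. *)
Notation tile := (nat * nat * nat)%type.

Definition tile_in_grid (K : nat) (t : tile) : bool :=
  [&& 0 < t.2, t.1.1 + t.2 <= K & t.1.2 + t.2 <= K]%N.

Definition tile_apart (t t' : tile) : bool :=
  [|| t.1.1 + t.2 <= t'.1.1, t'.1.1 + t'.2 <= t.1.1,
      t.1.2 + t.2 <= t'.1.2 | t'.1.2 + t'.2 <= t.1.2]%N.

Lemma tile_apartC : symmetric tile_apart.
Proof. by move=> t t'; rewrite /tile_apart orbCA; do 2 congr orb; rewrite orbC. Qed.

Definition free_cells (K : nat) (F : seq tile) : seq tile :=
  [seq c <- [seq (u, v, 1%N) | u <- iota 0 K, v <- iota 0 K] |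
    all (tile_apart^~ c) F].

Definition fill_grid (K : nat) (F : seq tile) : seq tile := F ++ free_cells K F.

Lemma uniq_grid (u v w z : nat) :
  uniq [seq (x, y, 1%N) | x <- iota u w, y <- iota v z].
Proof. by rewrite allpairs_uniq ?iota_uniq // => -[? ?] [? ?] _ _ [-> ->]. Qed.

(** Adding a tile of side [w] to [F] removes at most [w ^ 2] cells: a cell that is not apart from
    the tile has its corner among the [w * w] lattice points of the tile. *)
Lemma size_free_cells (K : nat) (F : seq tile) :
  (K ^ 2 <= size (free_cells K F) + \sum_(t <- F) t.2 ^ 2)%N.
Proof.
elim: F => [|t F IH].
  by rewrite /free_cells filter_predT size_allpairs size_iota big_nil addn0.
apply: leq_trans IH _; rewrite big_cons addnA leq_add2r.
rewrite -(count_predC (tile_apart t) (free_cells K F)) -size_filter.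
rewrite -filter_predI leq_add2l -size_filter.
apply: leq_trans (_ : size [seq (x, y, 1%N) |
    x <- iota t.1.1 t.2, y <- iota t.1.2 t.2] <= _)%N.
  apply: uniq_leq_size; first by rewrite !filter_uniq ?uniq_grid.
  move=> c; rewrite !mem_filter => /and3P[/= napart _ /allpairsP[[x y] /=]].
  move=> [_ _ def_c]; rewrite {}def_c /tile_apart /= in napart *.
  by rewrite allpairs_f // mem_iota; lia.
by rewrite size_allpairs !size_iota.
Qed.

Lemma all_fill_grid (K : nat) (F : seq tile) :
  all (tile_in_grid K) F -> all (tile_in_grid K) (fill_grid K F).
Proof.
move=> F_in; rewrite all_cat F_in /=; apply/allP => c; rewrite mem_filter.
move=> /andP[_ /allpairsP[[x y] /= [+ + ->]]].
by rewrite !mem_iota /tile_in_grid /=; lia.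
Qed.

Lemma pairwise_fill_grid (K : nat) (F : seq tile) :
  pairwise tile_apart F -> pairwise tile_apart (fill_grid K F).
Proof.
move=> F_apart; rewrite pairwise_cat F_apart /=; apply/andP; split.
  by apply/allrelP => t c tF; rewrite mem_filter => /andP[/allP/(_ t tF)].
(* Distinct unit cells are apart, so uniqueness of the list gives pairwise apartness. *)
have := filter_uniq (fun c => all (tile_apart^~ c) F) (uniq_grid 0 0 K K).
rewrite uniq_pairwise; apply: (sub_in_pairwise (P := [in free_cells K F])); last exact/allP.
move=> c c'; rewrite !mem_filter.
move=> /andP[_ /allpairsP[[x y] /= [_ _ ->]]].
move=> /andP[_ /allpairsP[[x' y'] /= [_ _ ->]]].
by rewrite !xpair_eqE /tile_apart /=; lia.
Qed.

(** * Inputs made of [N] copies of a tiling, and their optimum *)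

Definition tiling_input (R : realType) (K : nat) (T : seq tile) (N : nat)
    : seq R :=
  flatten (nseq N [seq t.2%:R / K%:R | t <- T]).

Lemma nth_flatten_nseq (X : Type) (x0 : X) (N : nat) (r : seq X) (i : nat) :
  (i < N * size r)%N ->
  nth x0 (flatten (nseq N r)) i = nth x0 r (i %% size r).
Proof.
elim: N i => [//|N IH] i lt_i /=; rewrite nth_cat.
case: ltnP => [lt_ir|le_ri]; first by rewrite modn_small.
rewrite IH; last by lia.
by rewrite -[in RHS](subnK le_ri) modnDr.
Qed.

Section Tilings.
Variables (R : realType) (K : nat) (T : seq tile) (N : nat).
Hypothesis T_in : all (tile_in_grid K) T.
Hypothesis T_apart : pairwise tile_apart T.
Let s := tiling_input R K T N.

Lemma size_tiling_input : size s = (N * size T)%N.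
Proof.
by rewrite /s /tiling_input size_flatten /shape map_nseq sumn_nseq size_map mulnC.
Qed.

Lemma count_tiling_input (p : pred R) :
  count p s = (N * count (fun t => p (t.2%:R / K%:R)) T)%N.
Proof.
by rewrite /s /tiling_input count_flatten map_nseq sumn_nseq count_map mulnC.
Qed.

Lemma is_input_tiling : is_input s.
Proof.
move=> x /flattenP[r]; rewrite mem_nseq => /andP[_ /eqP->] /mapP[t tT ->].
have /and3P[t0 tK _] := allP T_in t tT.
have K0 : (0 < K)%N by lia.
by rewrite divr_gt0 ?ltr0n //= ler_pdivrMr ?ltr0n // mul1r ler_nat; lia.
Qed.

Let tile_at i := nth (0, 0, 0)%N T (i %% size T).

Lemma nth_tiling_input i : (i < size s)%N -> s`_i = (tile_at i).2%:R / K%:R.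
Proof.
rewrite size_tiling_input => i_s; rewrite nth_flatten_nseq size_map //.
by rewrite (nth_map (0, 0, 0)%N) // ltn_mod; lia.
Qed.

Let corner (t : tile) (k : 'I_2) : nat := if k == 0 then t.1.1 else t.1.2.

Lemma tile_apart_corner t t' : tile_apart t t' ->
  exists k, (corner t k + t.2 <= corner t' k)%N
         \/ (corner t' k + t'.2 <= corner t k)%N.
Proof.
case/or4P => ?; [exists 0 | exists 0 | exists 1 | exists 1]; rewrite /corner /=; lia.
Qed.

(** Each copy of [T] gets a bin of its own: the quotient of the index by [size T] is the bin, the
    remainder selects the tile. *)
Lemma tiling_packing :
  exists P : nat -> placement R 2, is_packing s P /\ (num_bins s P <= N)%N.
Proof.
pose P i : placement R 2 :=
  ((i %/ size T)%N, \row_k ((corner (tile_at i) k)%:R / K%:R)).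
have at_T i : (i < size s)%N -> (i %% size T < size T)%N.
  by rewrite size_tiling_input ltn_mod; lia.
have at_in i : (i < size s)%N -> tile_in_grid K (tile_at i).
  by move=> i_s; apply: (allP T_in); apply: mem_nth; exact: at_T.
exists P; split; [split|].
- move=> i i_s x xi k; rewrite mxE add0r.
  have := xi k; rewrite nth_tiling_input // mxE => /andP[lo hi].
  have /and3P[t0 tu tv] := at_in i i_s.
  have K0 : 0 < K%:R :> R by rewrite ltr0n; lia.
  rewrite (le_trans _ lo) ?divr_ge0 ?ler0n //= (le_trans hi) //.
  rewrite -mulrDl ler_pdivrMr // mul1r -natrD ler_nat /corner.
  by case: ifP => _.
- move=> i j i_s j_s neq_ij /= bin_ij.
  have K0 : 0 < K%:R :> R by have /and3P[] := at_in i i_s; rewrite ltr0n; lia.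
  have neq_mod : (i %% size T)%N != (j %% size T)%N.
    apply/eqP => mod_ij; apply: neq_ij.
    by rewrite (divn_eq i (size T)) (divn_eq j (size T)) bin_ij mod_ij.
  have /tile_apart_corner[k apart_k] : tile_apart (tile_at i) (tile_at j).
    have T_nth := pairwiseP (0, 0, 0)%N T_apart.
    case: (ltngtP (i %% size T) (j %% size T)) neq_mod => // lt_ij _.
      exact: T_nth (at_T i i_s) (at_T j j_s) lt_ij.
    by rewrite tile_apartC; exact: T_nth (at_T j j_s) (at_T i i_s) lt_ij.
  apply/seteqP; split => x // [/(_ k) + /(_ k)].
  rewrite !nth_tiling_input // !mxE -!mulrDl -!natrD.
  rewrite !ltr_pdivrMr // !ltr_pdivlMr //.
  move=> /andP[xi_lo xi_hi] /andP[xj_lo xj_hi].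
  by case: apart_k; rewrite -(ler_nat R); lra.
- rewrite /num_bins -[X in (_ <= X)%N](size_iota 0).
  apply: uniq_leq_size; first exact: undup_uniq.
  move=> b; rewrite mem_undup => /mapP[i]; rewrite !mem_iota /= !add0n.
  by rewrite size_tiling_input => i_s ->; rewrite ltn_divLR //; lia.
Qed.

End Tilings.

(** Case [q = 0] of the grid argument: every such open cube contains the centre of its bin. *)
Lemma count_gt_half_le_bins (R : realType) (d : nat) (s : seq R)
    (P : nat -> placement R d) :
  is_packing s P -> (count (fun x : R => 1 / 2 < x)%R s <= num_bins s P)%N.
Proof.
move=> Pp; rewrite -num_items_value (num_items_sum_bins _ P) /num_bins -sum1_size.
apply: leq_sum => b _; apply: (leq_trans (big_items_in_bin (q := 0) Pp _ _)).
  by move=> i _.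
by rewrite exp1n.
Qed.

Lemma is_OPT_tiling (R : realType) (K : nat) (T : seq tile) (N : nat) :
  all (tile_in_grid K) T -> pairwise tile_apart T ->
  has (fun t => 1 / 2 < t.2%:R / K%:R :> R) T ->
  is_OPT 2 (tiling_input R K T N) N.
Proof.
move=> T_in T_apart T_big.
have lower (P : nat -> placement R 2) : is_packing (tiling_input R K T N) P ->
    (N <= num_bins (tiling_input R K T N) P)%N.
  move=> /count_gt_half_le_bins; apply: leq_trans.
  by rewrite count_tiling_input -[X in (X <= _)%N]muln1 leq_mul2l -has_count T_big orbT.
split=> //; have [P [Pp le_N]] := tiling_packing R N T_in T_apart.
by exists P; split=> //; apply/eqP; rewrite eqn_leq le_N lower.
Qed.

(** * Weighting the bins of the algorithm *)

Section BinsOfTheAlgorithm.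
Variables (R : realType) (A : online_algorithm R 2).
Variables (IL IM IS : interval R) (K : nat).
Hypothesis K_gt0 : (0 < K)%N.
Hypothesis IL_big : forall x, x \in IL -> 1 / 2 < x.
Hypothesis IM_big : forall x, x \in IM -> 1 / 3 < x <= 1 / 2.
Hypothesis sepSL : never_together A IS IL.
Hypothesis sepSM : never_together A IS IM.

Variables (s : seq R) (red : pred nat).
Hypothesis s_in : is_input s.
Hypothesis s_big : forall i, (i < size s)%N -> 1 / K.+1%:R < s`_i.

Let P := run A s.
Let larges := [pred i | s`_i \in IL].
Let mediums := [pred i | s`_i \in IM].
Let sands := [pred i | s`_i \in IS].
Let reds := [pred i | s`_i \in IM & red i].
Let blues := [pred i | s`_i \in IM & ~~ red i].

Lemma num_irregularE c q : num_irregular A s c q =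
  (\sum_(b <- used_bins s P) (items_in s P c b \notin [:: 0; q]))%N.
Proof. by rewrite -[LHS]sum1_count big_mkcond. Qed.

Lemma reds_blues_in b :
  (items_in s P reds b + items_in s P blues b = items_in s P mediums b)%N.
Proof.
rewrite items_in_disjoint => [|i _ /andP[_ ri]]; last by rewrite /= ri andbF.
by apply: eq_count => i /=; case: (red i); rewrite ?andbT ?andbF ?orbF.
Qed.

Lemma reds_blues_num :
  (num_items s reds + num_items s blues = num_items s mediums)%N.
Proof.
rewrite !(num_items_sum_bins _ P) -big_split.
by apply: eq_bigr => b _; exact: reds_blues_in.
Qed.

Lemma bin_content b :
  let nL := items_in s P larges b in
  let nM := (items_in s P reds b + items_in s P blues b)%N in
  let nS := items_in s P sands b in
  [/\ nL <= 1, nS <= K ^ 2, nL + nM <= 4,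
      nS = 0 \/ nL = 0 & nS = 0 \/ nM = 0]%N.
Proof.
have Pp : is_packing s P := run_is_packing A s_in.
rewrite /= reds_blues_in; split.
- rewrite -[X in (_ <= X)%N](exp1n 2); apply: (big_items_in_bin Pp) => i _.
  exact: IL_big.
- rewrite -(prednK K_gt0); apply: (big_items_in_bin Pp) => i i_s _.
  by rewrite prednK //; exact: s_big.
- rewrite items_in_disjoint => [|i _ /IL_big i_big]; last first.
    by apply/negP => /IM_big /andP[_]; lra.
  apply: (big_items_in_bin (q := 1) Pp) => i _ /orP[/IL_big|/IM_big]; lra.
- by apply: items_in_separated => i k i_s k_s; exact: sepSL.
- by apply: items_in_separated => i k i_s k_s; exact: sepSM.
Qed.

(** Weights: 1 for a large item, 1/4 for a blue one, [1 / K ^ 2] for sand, 0 for a red one. A bin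
    with four blue items has no room for a large one, so its weight is at most 1; a bin with one to
    three blue items is irregular and is counted twice on the right. *)
Lemma bins_ge_blue :
  (num_items s larges)%:R + (num_items s blues)%:R / 4
    + (num_items s sands)%:R / K%:R ^+ 2
  <= (num_bins s P)%:R + (num_irregular A s blues 4)%:R :> R.
Proof.
(* [Q] hides the power from the arithmetic tactics; multiplying by [4 * Q] clears the
   denominators. *)
have [Q QE] : {Q | Q = K ^ 2}%N by exists (K ^ 2)%N.
have : (4 * Q * num_items s larges + Q * num_items s blues
    + 4 * num_items s sands
    <= 4 * Q * (num_bins s P + num_irregular A s blues 4))%N.
  rewrite num_irregularE /num_bins -sum1_size -big_split /=.
  rewrite !(num_items_sum_bins _ P) !big_distrr -!big_split /=.
  apply: leq_sum => b _; have := bin_content b; rewrite -QE.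
  move: (items_in s P larges b) (items_in s P reds b) (items_in s P blues b)
    (items_in s P sands b) => nL nR nB nS [nL1 nSQ nLM [->|nL0] [nS0|nM0]];
    rewrite !inE; nia.
rewrite -(ler_nat R) !(natrD, natrM) => le_nat.
have Q0 : 0 < Q%:R :> R by rewrite QE natrX exprn_gt0 ?ltr0n.
rewrite -natrX -QE; set q := Q%:R in Q0 le_nat *.
rewrite -(ler_pM2l (_ : 0 < 4 * q)) ?mulr_gt0 ?ltr0Sn //.
rewrite [leLHS](_ : _ = 4 * q * (num_items s larges)%:R
  + q * (num_items s blues)%:R + 4 * (num_items s sands)%:R) //.
by field; rewrite gt_eqF.
Qed.

(** Red items now weigh 1/3. Large items are alone among the heavy ones, and a bin mixing red and
    blue items is irregular, since three red and four blue items exceed the capacity four. *)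
Lemma bins_ge_red_blue : never_together A IL IM ->
  (num_items s larges)%:R + (num_items s reds)%:R / 3
    + (num_items s blues)%:R / 4 + (num_items s sands)%:R / K%:R ^+ 2
  <= (num_bins s P)%:R + (num_irregular A s reds 3)%:R
    + (num_irregular A s blues 4)%:R :> R.
Proof.
move=> sepLM; have [Q QE] : {Q | Q = K ^ 2}%N by exists (K ^ 2)%N.
have : (12 * Q * num_items s larges + 4 * Q * num_items s reds
    + 3 * Q * num_items s blues + 12 * num_items s sands
    <= 12 * Q * (num_bins s P + num_irregular A s reds 3
                 + num_irregular A s blues 4))%N.
  rewrite !num_irregularE /num_bins -sum1_size -!big_split /=.
  rewrite !(num_items_sum_bins _ P) !big_distrr -!big_split /=.
  apply: leq_sum => b _; have := bin_content b; rewrite -QE.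
  have : items_in s P larges b = 0%N
      \/ (items_in s P reds b + items_in s P blues b = 0)%N.
    rewrite reds_blues_in; apply: items_in_separated => i k i_s k_s.
    exact: sepLM.
  move: (items_in s P larges b) (items_in s P reds b) (items_in s P blues b)
    (items_in s P sands b) => nL nR nB nS.
  move=> LM [nL1 nSQ nLM SL SM]; rewrite !inE.
  (* Either the bin has no sand, or it has only sand among the weighted items. *)
  have [nS0|[-> [-> ->]]] : nS = 0%N \/ nL = 0%N /\ nR = 0%N /\ nB = 0%N by lia.
    have : (12 * nL + 4 * nR + 3 * nB <= 12 * (1
      + ~~ ((nR == 0) || (nR == 3)) + ~~ ((nB == 0) || (nB == 4))))%N by lia.
    by move=> /(leq_mul (leqnn Q)); rewrite nS0; lia.
  by rewrite /=; lia.
rewrite -(ler_nat R) !(natrD, natrM) => le_nat.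
have Q0 : 0 < Q%:R :> R by rewrite QE natrX exprn_gt0 ?ltr0n.
rewrite -natrX -QE; set q := Q%:R in Q0 le_nat *.
rewrite -(ler_pM2l (_ : 0 < 12 * q)) ?mulr_gt0 ?ltr0Sn //.
rewrite [leLHS](_ : _ = 12 * q * (num_items s larges)%:R
  + 4 * q * (num_items s reds)%:R + 3 * q * (num_items s blues)%:R
  + 12 * (num_items s sands)%:R) //.
by field; rewrite gt_eqF.
Qed.

End BinsOfTheAlgorithm.

(** * The hard inputs: four corner squares and sand *)

Definition corner_tiles (K a l : nat) : seq tile :=
  [:: (0, 0, l); (K - a, 0, a); (0, K - a, a); (K - a, K - a, a)]%N.

Definition corner_input (R : realType) (K a l N : nat) : seq R :=
  tiling_input R K (fill_grid K (corner_tiles K a l)) N.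

Section CornerInput.
Variables (R : realType) (K a l N : nat).
Hypothesis a_gt0 : (0 < a)%N.
Hypothesis l_gt0 : (0 < l)%N.
Hypothesis le_a : (a + a <= K)%N.
Hypothesis le_l : (l + a <= K)%N.
Let s := corner_input R K a l N.

Let tiles_in : all (tile_in_grid K) (fill_grid K (corner_tiles K a l)).
Proof. by apply: all_fill_grid; rewrite /= /tile_in_grid /=; lia. Qed.

Let tiles_apart : pairwise tile_apart (fill_grid K (corner_tiles K a l)).
Proof. by apply: pairwise_fill_grid; rewrite /= /tile_apart /=; lia. Qed.

Lemma is_input_corner : is_input s.
Proof. exact: is_input_tiling. Qed.

Lemma is_OPT_corner : (K < l + l)%N -> is_OPT 2 s N.
Proof.
move=> lt_K; apply: is_OPT_tiling => //=.
have K0 : 0 < K%:R :> R by rewrite ltr0n; lia.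
have : K%:R < l%:R + l%:R :> R by rewrite -natrD ltr_nat.
by rewrite ltr_pdivlMr // => lt_K'; apply/orP; left; lra.
Qed.

Lemma corner_input_gt i : (i < size s)%N -> 1 / K.+1%:R < s`_i.
Proof.
move=> i_s; have /flattenP[r] := mem_nth 0 i_s.
rewrite mem_nseq => /andP[_ /eqP->] /mapP[t tT ->].
have /and3P[t0 _ _] := allP tiles_in t tT.
have K0 : (0 < K)%N by lia.
rewrite ltr_pdivlMr ?ltr0n // mulrAC ltr_pdivrMr ?ltr0n // mul1r.
by rewrite -natrM ltr_nat; nia.
Qed.

Lemma count_corner_input (p : pred R) : count p s =
  (N * (p (l%:R / K%:R)%R + 3 * p (a%:R / K%:R)%R
        + p (1 / K%:R)%R * size (free_cells K (corner_tiles K a l))))%N.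
Proof.
rewrite /s /corner_input count_tiling_input count_cat /=.
rewrite (eq_in_count (a1 := fun t : tile => _) (a2 := fun=> p (1 / K%:R))).
  congr (N * (_ + _))%N.
  by case: (p (1 / K%:R)); rewrite ?count_predT ?count_pred0 ?mul1n.
by move=> t; rewrite mem_filter => /andP[_ /allpairsP[[u v] /= [_ _ ->]]].
Qed.

(** The right-hand side is the total weight of the sand in one copy; it is at least the area that
    the four corner squares leave free. *)
Lemma corner_free_area :
  1 - (l%:R / K%:R) ^+ 2 - 3 * (a%:R / K%:R) ^+ 2
  <= (size (free_cells K (corner_tiles K a l)))%:R / K%:R ^+ 2 :> R.
Proof.
have := size_free_cells K (corner_tiles K a l).
rewrite !big_cons big_nil /= addn0 -(ler_nat R) !natrD !natrX => le_K.
have K0 : 0 < K%:R ^+ 2 :> R by rewrite exprn_gt0 // ltr0n; lia.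
rewrite ler_pdivlMr // !expr_div_n [leLHS](_ : _ =
  K%:R ^+ 2 - l%:R ^+ 2 - 3 * a%:R ^+ 2); first lra.
by field; rewrite pnatr_eq0; lia.
Qed.

End CornerInput.

Section CornerBins.
Variables (R : realType) (A : online_algorithm R 2).
Variables (IL IM IS : interval R) (K a l N : nat).
Hypothesis IL_big : forall x, x \in IL -> 1 / 2 < x.
Hypothesis IM_big : forall x, x \in IM -> 1 / 3 < x <= 1 / 2.
Hypothesis IS_small : forall x, x \in IS -> x <= 1 / 3.
Hypothesis sepSL : never_together A IS IL.
Hypothesis sepSM : never_together A IS IM.
Hypothesis a_gt0 : (0 < a)%N.
Hypothesis l_gt0 : (0 < l)%N.
Hypothesis le_a : (a + a <= K)%N.
Hypothesis le_l : (l + a <= K)%N.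
Hypothesis lIL : l%:R / K%:R \in IL.
Hypothesis aIM : a%:R / K%:R \in IM.
Hypothesis sIS : 1 / K%:R \in IS.
Let s := corner_input R K a l N.
Let free : R := 1 - (l%:R / K%:R) ^+ 2 - 3 * (a%:R / K%:R) ^+ 2.

Lemma num_items_corner_large :
  (N <= num_items s [pred i | s`_i \in IL]%R)%N.
Proof.
rewrite (num_items_value s [in IL]) count_corner_input /= lIL; nia.
Qed.

(** An equality, because the red fraction refers to the exact number of medium items. *)
Lemma num_items_corner_medium :
  num_items s [pred i | s`_i \in IM] = (3 * N)%N.
Proof.
rewrite (num_items_value s [in IM]) count_corner_input /= aIM.
rewrite (_ : _ \in IM = false); last first.
  by apply/negP => /IM_big; have := IL_big lIL; lra.
rewrite (_ : _ \in IM = false); last first.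
  by apply/negP => /IM_big; have := IS_small sIS; lra.
by rewrite mul0n addn0 add0n muln1 mulnC.
Qed.

Lemma num_items_corner_sand :
  N%:R * free <= (num_items s [pred i | s`_i \in IS])%:R / K%:R ^+ 2.
Proof.
apply: le_trans (_ : N%:R * ((size (free_cells K (corner_tiles K a l)))%:R
  / K%:R ^+ 2) <= _).
  by rewrite ler_wpM2l ?ler0n //; exact: corner_free_area.
rewrite mulrA ler_wpM2r ?invr_ge0 ?exprn_ge0 ?ler0n // -natrM ler_nat.
by rewrite (num_items_value s [in IS]) count_corner_input /= sIS; nia.
Qed.

Variables (red : pred nat) (m e : R).
Let reds := [pred i | s`_i \in IM & red i].
Let blues := [pred i | s`_i \in IM & ~~ red i].
Hypothesis red_fraction : `|(num_items s reds)%:R - (3 * N)%:R / m| <= e.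
Hypothesis blue_regular : (num_irregular A s blues 4)%:R <= e.

(** There are at least [3 * N * (1 - 1 / m) - e] blue items, each of weight 1/4; together with the
    large items they give [7 / 4 - 3 / 4 / m]. *)
Lemma corner_bins_ge_blue :
  N%:R * (7 / 4 - 3 / 4 / m + free) - 2 * e <= (num_bins s (run A s))%:R.
Proof.
have s_big := @corner_input_gt R K a l N a_gt0 l_gt0 le_a le_l.
have s_in := @is_input_corner R K a l N a_gt0 l_gt0 le_a le_l.
have K0 : (0 < K)%N by lia.
have := bins_ge_blue K0 IL_big IM_big sepSL sepSM red s_in s_big.
have := reds_blues_num A IM s red; rewrite -/s -/reds -/blues.
rewrite num_items_corner_medium => /(congr1 (GRing.natmul (1 : R))).
rewrite natrD natrM => num_medium.
have large : N%:R <= (num_items s [pred i | s`_i \in IL])%:R :> R.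
  by rewrite ler_nat; exact: num_items_corner_large.
move: red_fraction blue_regular num_items_corner_sand.
rewrite natrM ler_distl => /andP[_ fraction] regular sand bins.
(* This gives [0 <= e], so the actual error [5 / 4 * e] is at most [2 * e]. *)
have := ler0n R (num_irregular A s blues 4).
move: fraction sand; rewrite -mulrA; move: (m^-1) (free) => x f fraction sand.
by rewrite !mulrDr mulrN; lra.
Qed.

Hypothesis red_regular : (num_irregular A s reds 3)%:R <= e.

(** The medium items weigh 1/4 each, [3 / 4 * N] in all, and every red one 1/12 more, which adds
    about [N / (4 * m)]. *)
Lemma corner_bins_ge_red_blue : never_together A IL IM ->
  N%:R * (7 / 4 + 1 / 4 / m + free) - 3 * e <= (num_bins s (run A s))%:R.
Proof.
move=> sepLM; have s_big := @corner_input_gt R K a l N a_gt0 l_gt0 le_a le_l.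
have s_in := @is_input_corner R K a l N a_gt0 l_gt0 le_a le_l.
have K0 : (0 < K)%N by lia.
have := bins_ge_red_blue K0 IL_big IM_big sepSL sepSM red s_in s_big sepLM.
have := reds_blues_num A IM s red; rewrite -/s -/reds -/blues.
rewrite num_items_corner_medium => /(congr1 (GRing.natmul (1 : R))).
rewrite natrD natrM => num_medium.
have large : N%:R <= (num_items s [pred i | s`_i \in IL])%:R :> R.
  by rewrite ler_nat; exact: num_items_corner_large.
move: red_fraction red_regular blue_regular num_items_corner_sand.
rewrite natrM ler_distl => /andP[fraction _] regR regB sand bins.
have := ler0n R (num_irregular A s reds 3).
move: fraction sand; rewrite -mulrA; move: (m^-1) (free) => x f fraction sand.
by rewrite !mulrDr; lra.
Qed.

End CornerBins.

(** * Numerical bound, choice of the grid, and conclusion *)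

(* A bin of the first input holds a square of side [2/3 - k/3], which the
   algorithm never packs with the three squares of side [1/3 + k/3] next to it;
   in the second input the big square has side [1/2 + k].  Here [k] is the side
   of the smallest items and [x] is the fraction of the red items: the first
   bound increases with [x], the second one decreases three times as fast. *)
Lemma combined_bound (R : realType) (n x k e b1 b2 : R) :
  0 < n -> 0 < k <= 1 / 10 ^+ 6 -> e <= n / 10 ^+ 6 ->
  n * (7 / 4 + 1 / 4 * x
       + (1 - (2 / 3 - k / 3) ^+ 2 - 3 * (1 / 3 + k / 3) ^+ 2)) - 3 * e <= b1 ->
  n * (7 / 4 - 3 / 4 * x
       + (1 - (1 / 2 + k) ^+ 2 - 3 * (1 / 3 + k / 3) ^+ 2)) - 2 * e <= b2 ->
  (2 + 208 / 100 ^+ 2) * n <= b1 \/ (2 + 208 / 100 ^+ 2) * n <= b2.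
Proof.
move=> n0 /andP[k0 k1] le_e ge1 ge2; apply/orP; rewrite -[_ || _]negbK negb_or.
apply/negP; rewrite -!ltNge => /andP[lt1 lt2].
(* The products of [n] with powers of [k] become atoms, so that the rest is linear. *)
have kk : k * k <= k by rewrite -[leRHS]mulr1 ler_pM2l //; lra.
have nk : n * k <= n / 10 ^+ 6 by rewrite ler_pM2l //; lra.
have nkk : n * (k * k) <= n * k by rewrite ler_pM2l.
have nkk0 : 0 <= n * (k * k) by rewrite !mulr_ge0 // ltW.
have nk0 : 0 < n * k by rewrite mulr_gt0.
(* Three quarters of [ge1] plus one quarter of [ge2] eliminates [x]; 97/48 exceeds the claimed
   constant by 1/30000, more than the errors in [k] and [e]. *)
by lra.
Qed.

Lemma exists_fine_grid (R : realType) (delta : R) : 0 < delta ->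
  exists K a l1 l2 : nat,
  [/\ [/\ 0 < a, 0 < l1 & 0 < l2]%N,
      [/\ a + a <= K, l1 + a <= K & l2 + a <= K]%N,
      (K < l1 + l1)%N /\ (K < l2 + l2)%N,
      0 < (1 / K%:R : R) < delta
    & [/\ a%:R / K%:R = 1 / 3 + 1 / K%:R / 3 :> R,
          l1%:R / K%:R = 2 / 3 - 1 / K%:R / 3 :> R
        & l2%:R / K%:R = 1 / 2 + 1 / K%:R :> R]].
Proof.
move=> d0; pose t := Num.bound delta^-1.
(* With [K] congruent to 2 modulo 6, the sides [(K + 1) / 3], [(2 * K - 1) / 3] and [K / 2 + 1] are
   integers, and the first two add up to [K]. *)
exists (6 * t + 8)%N, (2 * t + 3)%N, (4 * t + 5)%N, (3 * t + 5)%N.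
have K0 : 0 < (6 * t + 8)%:R :> R by rewrite ltr0n addn_gt0 orbT.
split; [by split; lia | by split; lia | by split; lia | |].
  rewrite divr_gt0 //= ltr_pdivrMr // -ltr_pdivrMl // mulr1.
  apply: (lt_le_trans (archi_boundP _)); first by rewrite invr_ge0 ltW.
  by rewrite ler_nat -/t; lia.
by split; move: K0; rewrite !natrD !natrM => K0; field; rewrite gt_eqF.
Qed.

Theorem theorem2 (R : realType) (A : online_algorithm R 2)
    (hA : harmonic_type A) :
  ((2 + 208 / 100 ^+ 2 : R)%R%:E <= asymptotic_ratio A)%E.
Proof.
have [h [y [lambda [h_gt0 [y0 yh y_incr] /andP[l0 lambda_le] rules]]]] := hA.
pose Y j : R := ratr (y j).
have Y0 : Y 0 = 1 / 3 by rewrite /Y y0 fmorph_div !rmorphE.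
have Yh : Y h.+1 = 1 / 2 by rewrite /Y yh fmorph_div !rmorphE.
have Y_incr j : (j <= h)%N -> Y j < Y j.+1 by rewrite ltr_rat; exact: y_incr.
have Y1h j : (j < h)%N -> Y 1 < Y j.+2.
  elim: j => [|j IH] lt_j; first exact: Y_incr.
  by apply: (lt_trans (IH (ltnW lt_j))); exact: Y_incr.
have Y1_lt : Y 1 < 1 / 2.
  by rewrite -Yh -(prednK h_gt0); apply: Y1h; rewrite prednK.
have Y01 : 1 / 3 < Y 1 by rewrite -Y0; exact: Y_incr.
have Yh_lt : Y h < 1 / 2 by rewrite -Yh; exact: Y_incr.
(* All rules are used at [j = h], where [I2 h] is [(1/3, y_1]] and [I1 h] is [(1/2, 1 - y_h]]. *)
case: rules => /(_ h) red_rule _ /(_ h) sep_bar1 _.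
move=> [/(_ h) sepS1 /(_ h) sepS2 sepSbar1 _].
have hh : (1 <= h <= h)%N by rewrite h_gt0 leqnn.
move: (red_rule hh) (sep_bar1 hh) (sepS1 hh) (sepS2 hh) sepSbar1.
rewrite subnn -/(Y 0) -/(Y 1) -/(Y h) -/(Y h.+1) Y0 Yh.
move=> {red_rule sep_bar1 sepS1 sepS2} [m [_ [red red_rule]]].
move=> sep12 sepS1 sepS2 sepSbar1.
have [|C rule] := red_rule (1 / 10 ^+ 8); first by rewrite divr_gt0 ?exprn_gt0.
(* A cell side below [delta] puts the sand in [(0, lambda]], the medium squares below [Y 1], the
   large ones above [1 - Y 1] and below [1 - Y h] respectively, and meets the precision of
   [combined_bound]. *)
pose delta := Num.min (Num.min lambda (Y 1 - 1 / 3))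
  (Num.min (1 / 2 - Y h) (1 / 10 ^+ 6)).
have d0 : 0 < delta.
  by rewrite !lt_min l0 !subr_gt0 Y01 Yh_lt divr_gt0 ?exprn_gt0.
have [K [a [l1 [l2 [[a_gt0 l1_gt0 l2_gt0] [le_a le_l1 le_l2] [lt_l1 lt_l2]]]]]] :=
  exists_fine_grid d0.
move=> /andP[k0]; rewrite !lt_min.
move=> /andP[/andP[k_lambda k_Y1] /andP[k_Yh k_small]] [aE l1E l2E].
have IM_big (x : R) : x \in `]1 / 3, Y 1] -> 1 / 3 < x <= 1 / 2.
  by rewrite in_itv /= => /andP[-> x1] /=; lra.
have IS_small (x : R) : x \in `]0, lambda] -> x <= 1 / 3.
  by rewrite in_itv /= => /andP[]; lra.
have aIM : a%:R / K%:R \in `]1 / 3, Y 1] by rewrite aE in_itv /=; lra.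
have sIS : 1 / K%:R \in `]0, lambda] by rewrite in_itv /= k0 ltW.
pose N0 := (Num.bound (10 ^+ 8 * `|C|)).+1.
apply: (@limn_esup_ge _ _ _ N0) => N le_N.
have N_gt0 : 0 < N%:R :> R by rewrite ltr0n; apply: leq_trans le_N.
have C_le : C <= N%:R / 10 ^+ 8.
  rewrite ler_pdivlMr ?exprn_gt0 // mulrC.
  have := archi_boundP (_ : 0 <= 10 ^+ 8 * `|C|).
  rewrite mulr_ge0 ?exprn_ge0 ?normr_ge0 // => /(_ isT) lt_C.
  have : N0%:R <= N%:R :> R by rewrite ler_nat.
  by rewrite /N0 -natr1; have := ler_norm C; lra.
(* The error of the red-blue rule for [3 * N] medium items; it is at most [4 * N / 10 ^+ 8]. *)
pose e : R := 1 / 10 ^+ 8 * (3 * N)%:R + C.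
have le_e : e <= N%:R / 10 ^+ 6 by rewrite /e natrM; lra.
have ratio l : (0 < l)%N -> (l + a <= K)%N -> (K < l + l)%N ->
    (2 + 208 / 100 ^+ 2) * N%:R
      <= (num_bins (corner_input R K a l N) (run A (corner_input R K a l N)))%:R :> R ->
    ((2 + 208 / 100 ^+ 2 : R)%R%:E <= ereal_sup
      [set ((num_bins s (run A s))%:R / N%:R)%:E |
        s in [set s : seq R | is_input s /\ is_OPT 2 s N]])%E.
  move=> l_gt0 le_l lt_l ge_bins.
  apply: (@le_trans _ _ ((num_bins (corner_input R K a l N)
    (run A (corner_input R K a l N)))%:R / N%:R)%:E).
    by rewrite lee_fin ler_pdivlMr.
  apply: ereal_sup_ubound; exists (corner_input R K a l N) => //; split.
    exact: is_input_corner.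
  exact: is_OPT_corner.
have rule_l l (IL : interval R) : (forall x, x \in IL -> 1 / 2 < x) ->
    (0 < l)%N -> (l + a <= K)%N -> l%:R / K%:R \in IL ->
    let s := corner_input R K a l N in
    let reds := [pred i | s`_i \in `]1 / 3, Y 1] & red s i] in
    let blues := [pred i | s`_i \in `]1 / 3, Y 1] & ~~ red s i] in
    [/\ `|(num_items s reds)%:R - (3 * N)%:R / m| <= e,
        (num_irregular A s reds 3)%:R <= e & (num_irregular A s blues 4)%:R <= e].
  move=> IL_big l_gt0 le_l lIL; have := rule (corner_input R K a l N).
  rewrite (num_items_corner_medium _ IL_big IM_big IS_small lIL aIM sIS).
  by apply; exact: is_input_corner.
have I1_big (x : R) : x \in `]1 - Y 1, 1] -> 1 / 2 < x.
  by rewrite in_itv /= => /andP[]; lra.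
have I2_big (x : R) : x \in `]1 - 1 / 2, 1 - Y h] -> 1 / 2 < x.
  by rewrite in_itv /= => /andP[]; lra.
have l1IL : l1%:R / K%:R \in `]1 - Y 1, 1] by rewrite l1E in_itv /=; lra.
have l2IL : l2%:R / K%:R \in `]1 - 1 / 2, 1 - Y h].
  by rewrite l2E in_itv /=; lra.
have [frac1 regR1 regB1] := rule_l _ _ I1_big l1_gt0 le_l1 l1IL.
have [frac2 _ regB2] := rule_l _ _ I2_big l2_gt0 le_l2 l2IL.
have := corner_bins_ge_red_blue I1_big IM_big IS_small sepSbar1 sepS2 a_gt0
  l1_gt0 le_a le_l1 l1IL aIM sIS frac1 regB1 regR1 sep12.
have := corner_bins_ge_blue I2_big IM_big IS_small sepS1 sepS2 a_gt0
  l2_gt0 le_a le_l2 l2IL aIM sIS frac2 regB2.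
rewrite aE l1E l2E => ge2 ge1.
have k_bounds : 0 < (1 / K%:R : R) <= 1 / 10 ^+ 6 by rewrite k0 ltW.
(* Which input is the bad one may depend on [N]; the supremum over inputs with optimum [N] covers
   both cases. *)
case: (combined_bound N_gt0 k_bounds le_e ge1 ge2); exact: ratio.
Qed.
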